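(* Let $K$ be a field, $S=K[x_0,\ldots,x_n]$ with $x_0<x_1<\cdots<x_n$, let $J\subseteq S$ be a strongly stable monomial ideal, $G$ a $J$-marked set, and $I=(G)$. For every degree $m$, every term $x^\beta\in J_m\setminus B_J$ can be reduced to a $J$-reduced form modulo $I$ in a finite number of reduction steps, using only polynomials of $V_m$. Hence, the reduction relation $\stackrel{V_m}{\longrightarrow}$ is Noetherian in $S_m$ (there is no infinite sequence of reduction steps).
   Context: A term is a monomial $x^\alpha=x_0^{\alpha_0}\cdots x_n^{\alpha_n}$; for a term $x^\beta\neq 1$, $\min(x^\beta)$ is the smallest variable dividing it. A monomial ideal $J$ is strongly stable if for every term $x^\alpha\in J$ and all $0\le i<j\le n$ with $\alpha_i>0$, the term $x_j x^\alpha/x_i$ belongs to $J$. $B_J$ is the minimal set of monomial generators of $J$ and $\mathcal N(J)$ is the set of terms not in $J$; $S_m$, $J_m$ are the degree-$m$ homogeneous parts. A $J$-marked set is a finite set $G$ of homogeneous polynomials $f_\alpha=x^\alpha-\sum c_{\alpha\gamma}x^\gamma$, $c_{\alpha\gamma}\in K$, each with marked head term $Ht(f_\alpha)=x^\alpha$, whose head terms are pairwise different and form exactly $B_J$, and such that every $x^\gamma$ appearing belongs to $\mathcal N(J)$. A $J$-reduced form modulo $I$ of a homogeneous polynomial $h$ is a homogeneous polynomial $h_0$ with $h-h_0\in I$ and support contained in $\mathcal N(J)$. The sets $V_m$: to every term $x^\beta\in J$ associate a marked polynomial $g_\beta$ with $Ht(g_\beta)=x^\beta$, by induction on degree: if $x^\beta\in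 B_J$, $g_\beta$ is the element $f_\beta\in G$ with head term $x^\beta$; if $x^\beta\in J\setminus B_J$, put $x_i=\min(x^\beta)$, $x^\epsilon=x^\beta/x_i$ (which lies in $J$ by strong stability) and $g_\beta:=x_ig_\epsilon$. Then $V_m:=\{g_\beta : x^\beta\in J\text{ a term of degree }m\}$. A reduction step $h\stackrel{V_m}{\longrightarrow}h'$ on $S_m$ replaces $h\in S_m$ by $h'=h-a\,g_\beta$, where $x^\beta\in J$ is a term occurring in $h$ with coefficient $a\neq 0$ and $g_\beta\in V_m$. *)

(* Defs.v *)
From mathcomp Require Import all_boot all_order all_algebra.
From mathcomp Require Import mpoly.
From Stdlib Require Import Relation_Operators.

Set Implicit Arguments.
Unset Strict Implicit.
Unset Printing Implicit Defensive.

Import GRing.Theory.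
Local Open Scope ring_scope.

(* Terms are exponent vectors in 'X_{1..n.+1}: the variable x_i (0 <= i <= n)
   is 'X_i with i : 'I_n.+1, and x_i < x_j means i < j. *)

Definition ideal_gen (K : fieldType) (n : nat)
    (A : {mpoly K[n.+1]} -> Prop) (p : {mpoly K[n.+1]}) : Prop :=
  exists s : seq ({mpoly K[n.+1]} * {mpoly K[n.+1]}),
    (forall qa, qa \in s -> A qa.2) /\ p = \sum_(qa <- s) qa.1 * qa.2.

Definition monomial_generators (K : fieldType) (n : nat)
    (B : 'X_{1..n.+1} -> Prop) (J : {mpoly K[n.+1]} -> Prop) : Prop :=
  forall p, J p <-> ideal_gen (fun q => exists2 a, B a & q = 'X_[a]) p.

Definition monomial_ideal (K : fieldType) (n : nat)
    (J : {mpoly K[n.+1]} -> Prop) : Prop :=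
  exists B, monomial_generators B J.

Definition minimal_monomial_generators (K : fieldType) (n : nat)
    (B : 'X_{1..n.+1} -> Prop) (J : {mpoly K[n.+1]} -> Prop) : Prop :=
  monomial_generators B J /\
  forall B' : 'X_{1..n.+1} -> Prop,
    (forall a, B' a -> B a) -> monomial_generators B' J ->
    forall a, B a -> B' a.

(* (a - U_(i))%MM is truncated; the hypothesis 0 < a i makes it exact. *)
Definition strongly_stable (K : fieldType) (n : nat)
    (J : {mpoly K[n.+1]} -> Prop) : Prop :=
  forall (a : 'X_{1..n.+1}) (i j : 'I_n.+1),
    J 'X_[a] -> (i < j)%N -> (0 < a i)%N -> J 'X_[a - U_(i) + U_(j)].

(* A marked polynomial is encoded as the pair (head term, polynomial). *)
Definition marked_set (K : fieldType) (n : nat)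
    (J : {mpoly K[n.+1]} -> Prop) (B : 'X_{1..n.+1} -> Prop)
    (G : seq ('X_{1..n.+1} * {mpoly K[n.+1]})) : Prop :=
  [/\ uniq [seq f.1 | f <- G],
      forall a, a \in [seq f.1 | f <- G] <-> B a &
      forall f, f \in G ->
        [/\ f.2 \is homog mdeg,
            f.2@_(f.1) = 1 &
            forall c, c \in msupp f.2 -> c != f.1 -> ~ J 'X_[c]]].

Definition marked_ideal (K : fieldType) (n : nat)
    (G : seq ('X_{1..n.+1} * {mpoly K[n.+1]})) (p : {mpoly K[n.+1]}) : Prop :=
  ideal_gen (fun q => q \in [seq f.2 | f <- G]) p.

Definition is_min_var (n : nat) (b : 'X_{1..n.+1}) (i : 'I_n.+1) : Prop :=
  (0 < b i)%N /\ forall j : 'I_n.+1, (0 < b j)%N -> (i <= j)%N.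

(* Graph of the function sending a term x^b of J to g_b. *)
Inductive g_poly (K : fieldType) (n : nat)
    (J : {mpoly K[n.+1]} -> Prop) (B : 'X_{1..n.+1} -> Prop)
    (G : seq ('X_{1..n.+1} * {mpoly K[n.+1]})) :
    'X_{1..n.+1} -> {mpoly K[n.+1]} -> Prop :=
| g_poly_gen (b : 'X_{1..n.+1}) (f : {mpoly K[n.+1]}) :
    B b -> (b, f) \in G -> g_poly J B G b f
| g_poly_mul (b : 'X_{1..n.+1}) (i : 'I_n.+1) (g : {mpoly K[n.+1]}) :
    J 'X_[b] -> ~ B b -> is_min_var b i ->
    g_poly J B G (b - U_(i))%MM g -> g_poly J B G b ('X_i * g).

(* V_m, each element being paired with its head term. *)
Definition V_set (K : fieldType) (n : nat)
    (J : {mpoly K[n.+1]} -> Prop) (B : 'X_{1..n.+1} -> Prop)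
    (G : seq ('X_{1..n.+1} * {mpoly K[n.+1]})) (m : nat)
    (b : 'X_{1..n.+1}) (g : {mpoly K[n.+1]}) : Prop :=
  [/\ J 'X_[b], mdeg b = m & g_poly J B G b g].

(* b \in msupp h says that the coefficient h@_b is nonzero. *)
Definition red_step (K : fieldType) (n : nat)
    (J : {mpoly K[n.+1]} -> Prop) (B : 'X_{1..n.+1} -> Prop)
    (G : seq ('X_{1..n.+1} * {mpoly K[n.+1]})) (m : nat)
    (h h' : {mpoly K[n.+1]}) : Prop :=
  h \is m.-homog /\
  exists b g, [/\ b \in msupp h, V_set J B G m b g & h' = h - h@_b *: g].

Definition reduced_form (K : fieldType) (n : nat)
    (J I : {mpoly K[n.+1]} -> Prop) (h h0 : {mpoly K[n.+1]}) : Prop :=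
  [/\ h0 \is homog mdeg, I (h - h0) & forall c, c \in msupp h0 -> ~ J 'X_[c]].

(* Main.v *)
Require Import Defs.
From mathcomp Require Import all_boot all_order all_algebra.
From mathcomp Require Import mpoly zify.
From Stdlib Require Import Relation_Operators.

(** Unfolding the recursion, g_b = x^d f_a where b = d + a is the star
    decomposition of b: a is in B_J and no variable of x^d exceeds a variable of
    x^a.  If x^c in J is another term of g_b, then c = d + e with x^e not in J,
    and the cofactor of the star decomposition of c is smaller than d for the
    lexicographic order comparing top variables first.  In degree m the base
    m + 1 value of the cofactor encodes this order, so a reduction step trades a
    term of J for boundedly many terms of J of smaller rank, and a sum of
    exponential weights of the ranks decreases.  Strong stability is what makes
    g_b defined for every x^b in J, so that irreducible polynomials are reduced. *)

Set Implicit Arguments.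
Unset Strict Implicit.
Unset Printing Implicit Defensive.

Import GRing.Theory.

(** * Positional expansions and exponential weights *)

Lemma sum_digits_lt (D N : nat) (a : nat -> nat) :
  (forall k, a k < D) -> \sum_(k < N) a k * D ^ k < D ^ N.
Proof.
move=> aD; elim: N => [|N IH]; first by rewrite big_ord0.
rewrite big_ord_recr /= expnS; have := aD N; case: D aD IH => // D aD IH.
rewrite ltnS => aND; rewrite mulSn -addSn leq_add //.
by rewrite leq_mul2r aND orbT.
Qed.

(** The gain at position [j] is at least [D ^ j], which exceeds the total of the lower digits of
    [a]; the higher digits cancel. *)
Lemma lex_digits_lt (D N : nat) (a b : nat -> nat) (j : nat) :
  j < N -> a j < b j -> (forall k, j < k < N -> a k = b k) ->
  (forall k, a k < D) ->
  \sum_(k < N) a k * D ^ k < \sum_(k < N) b k * D ^ k.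
Proof.
move=> + abj + aD; elim: N => // N IH.
rewrite ltnS leq_eqVlt => /predU1P[<-|ltjN] ab; rewrite !big_ord_recr /=.
  apply: leq_trans (_ : a j * D ^ j + D ^ j <= _).
    by rewrite [in ltnLHS]addnC ltn_add2l sum_digits_lt.
  by rewrite addnC -mulSn (leq_trans _ (leq_addl _ _)) // leq_mul2r abj orbT.
rewrite -(ab N) ?ltjN /= // ltn_add2r; apply: IH => // k /andP[jk kN].
by apply: ab; rewrite jk ltnW.
Qed.

(** There are at most [#|T|] summands, each at most the base to the power [R - 1], and the base
    exceeds [#|T|]. *)
Lemma sum_expn_lt (T : finType) (P : pred T) (r : T -> nat) (R : nat) :
  (forall t, P t -> r t < R) -> \sum_(t | P t) #|T|.+1 ^ r t < #|T|.+1 ^ R.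
Proof.
case: R => [|R] rR; first by rewrite big_pred0 // => t; apply/negP => /rR.
apply: leq_ltn_trans (_ : \sum_(t : T) #|T|.+1 ^ R < _).
  rewrite [X in X <= _]big_mkcond leq_sum // => t _.
  by case: ifP => // /rR; rewrite ltnS => le_r; apply: leq_pexp2l.
by rewrite sum_nat_const expnS ltn_mul2r expn_gt0 ltnSn.
Qed.

(** * Star decompositions of terms *)

(** Membership of [x^c] in the Pommaret cone of [x^a], whose multiplicative variables are those up
    to [min(x^a)]. *)
Definition star_multiple {N : nat} (a c : 'X_{1..N}) : bool :=
  (a <= c)%MM &&
  [forall i, forall j, (0 < (c - a)%MM i) ==> (0 < a j) ==> (i <= j)].

Lemma star_multipleP {N : nat} (a c : 'X_{1..N}) :
  reflect ((a <= c)%MM /\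
           forall i j : 'I_N, 0 < (c - a)%MM i -> 0 < a j -> i <= j)
          (star_multiple a c).
Proof.
apply: (iffP andP) => -[le_ac h]; split=> //.
  by move=> i j; move: h => /forallP/(_ i)/forallP/(_ j) /implyP h ? ?; apply: (implyP (h _)).
by do 2!apply/forallP => ?; do 2!apply/implyP => ?; apply: h.
Qed.

Lemma star_multiple_refl {N : nat} (a : 'X_{1..N}) : star_multiple a a.
Proof.
apply/star_multipleP; split; first exact: lepm_refl.
by move=> i j; rewrite mnmBE subnn.
Qed.

(* If the cofactors [c - a] and [d] first differed, from the top variable down,
   at an index [j] where [c - a] is larger, then [a] would have no variable
   below [j], and comparing exponents from [j] on would give [a <= g]. *)
Lemma star_multiple_lex {N : nat} (d g a c : 'X_{1..N}) :
  star_multiple a c -> c = (d + g)%MM -> ~~ (a <= g)%MM ->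
  exists2 j : 'I_N, (c - a)%MM j < d j &
    forall k : 'I_N, j < k -> (c - a)%MM k = d k.
Proof.
move=> /star_multipleP[/mnm_lepP le_ac star] cE nag.
have cEi i : c i = d i + g i by rewrite cE mnmDE.
have [j0 nej0] : exists j : 'I_N, (c - a)%MM j != d j.
  apply/existsP; apply: contraNT nag; rewrite negb_exists => /forallP eq_ed.
  apply/mnm_lepP => i; have := eq_ed i; have := le_ac i.
  by rewrite negbK mnmBE cEi => le_a /eqP; lia.
case: (arg_maxnP (P := fun j : 'I_N => (c - a)%MM j != d j)
                 (fun j => nat_of_ord j) nej0) => j nej maxj.
have above (k : 'I_N) : j < k -> (c - a)%MM k = d k.
  by move=> jk; apply/eqP; apply: contraTT jk => /maxj; rewrite -leqNgt.
exists j => //; rewrite ltn_neqAle nej leqNgt /=.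
apply: contra nag => lt_de; apply/mnm_lepP => k.
have [kj|jk|/val_inj kj] := ltngtP k j.
- case: (posnP (a k)) => [->//|ak0].
  have := star j k (leq_ltn_trans (leq0n _) lt_de) ak0.
  by rewrite leqNgt kj.
- by have := above k jk; have := le_ac k; rewrite mnmBE cEi; lia.
- by move: lt_de; rewrite -kj mnmBE; have := le_ac k; rewrite cEi; lia.
Qed.

Lemma mnm_le_mdeg {N : nat} (c : 'X_{1..N}) (i : 'I_N) : c i <= mdeg c.
Proof. by rewrite mdegE (bigD1 i) //= leq_addr. Qed.

Local Open Scope ring_scope.

(** * Membership in ideals *)

Lemma ideal_gen_mem {K : fieldType} {n : nat} (A : {mpoly K[n.+1]} -> Prop) p q :
  A q -> ideal_gen A (p * q).
Proof.
move=> Aq; exists [:: (p, q)]; split; last by rewrite big_seq1.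
by move=> qa; rewrite inE => /eqP->.
Qed.

Lemma ideal_genD {K : fieldType} {n : nat} (A : {mpoly K[n.+1]} -> Prop) p q :
  ideal_gen A p -> ideal_gen A q -> ideal_gen A (p + q).
Proof.
move=> [s [sA ->]] [t [tA ->]]; exists (s ++ t); rewrite big_cat; split=> // x.
by rewrite mem_cat => /orP[/sA|/tA].
Qed.

(** If [x^b] is a combination of generators, some summand has a nonzero coefficient at [x^b], and
    all terms of that summand are multiples of its generator. *)
Lemma monomial_generators_mem {K : fieldType} {n : nat}
    (B : 'X_{1..n.+1} -> Prop) (J : {mpoly K[n.+1]} -> Prop) b :
  monomial_generators B J -> J 'X_[b] <-> exists2 a, B a & (a <= b)%MM.
Proof.
move=> genJ; rewrite (genJ 'X_[b]); split; last first.
  move=> [a Ba le_ab]; rewrite -(submK le_ab) mpolyXD.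
  by apply: ideal_gen_mem; exists a.
move=> [s [sA sumE]].
have : (\sum_(qa <- s) qa.1 * qa.2)@_b != 0.
  by rewrite -sumE mcoeffX eqxx oner_eq0.
elim: s sA {sumE} => [|[q p] s IH] sA; first by rewrite big_nil mcoeff0 eqxx.
have [qpb0|qpb _] := eqVneq ((q * p)@_b) 0.
  rewrite big_cons mcoeffD qpb0 add0r; apply: IH => x xs.
  by apply: sA; rewrite inE xs orbT.
have [a Ba /= pE] := sA _ (mem_head _ _); exists a => //.
move: qpb; rewrite pE -mcoeff_msupp (perm_mem (msuppMX _ _)).
by case/mapP=> c _ ->; apply: lem_addr.
Qed.

(** * Marked sets and their head terms *)

Section MarkedSet.

Variables (K : fieldType) (n : nat) (J : {mpoly K[n.+1]} -> Prop).
Variables (B : 'X_{1..n.+1} -> Prop) (G : seq ('X_{1..n.+1} * {mpoly K[n.+1]})).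
Hypotheses (HJs : strongly_stable J) (HB : minimal_monomial_generators B J).
Hypothesis HG : marked_set J B G.

(** A boolean form of membership in [J], available because the heads of the finite list [G] generate
    [J]. *)
Definition divisible_by_head (c : 'X_{1..n.+1}) : bool :=
  has (fun f : 'X_{1..n.+1} * {mpoly K[n.+1]} => (f.1 <= c)%MM) G.

Lemma head_generator f : f \in G -> B f.1.
Proof. by case: HG => _ hB _ fG; apply/hB; apply: map_f. Qed.

Lemma generator_marked a : B a -> exists p, (a, p) \in G.
Proof. by case: HG => _ hB _ /hB/mapP[[a' p] fG ->]; exists p. Qed.

Lemma divisible_by_headP c : reflect (J 'X_[c]) (divisible_by_head c).
Proof.
apply: (iffP hasP) => [[f fG le_fc]|].
  by apply/(monomial_generators_mem _ HB.1); exists f.1; first exact: head_generator.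
move/(monomial_generators_mem _ HB.1) => [a /generator_marked[p apG] le_ac].
by exists (a, p).
Qed.

Lemma marked_coeff f : f \in G -> f.2@_(f.1) = 1.
Proof. by case: HG => _ _ /[apply]-[]. Qed.

Lemma marked_homog f : f \in G -> f.2 \is (mdeg f.1).-homog.
Proof.
move=> fG; case: HG => _ _ /(_ f fG)[/homogP[d f_d] f1 _].
suff -> : mdeg f.1 = d by [].
by apply: (dhomogP _ _ _ f_d); rewrite mcoeff_msupp f1 oner_eq0.
Qed.

Lemma marked_tail f c :
  f \in G -> c \in msupp f.2 -> c != f.1 -> ~~ divisible_by_head c.
Proof.
move=> fG cf cnf; apply/divisible_by_headP.
by case: HG => _ _ /(_ f fG)[_ _]; apply.
Qed.

(** * Existence and shape of the polynomials of [V_m] *)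

Lemma exists_min_var (b : 'X_{1..n.+1}) : b != 0%MM -> exists i, is_min_var b i.
Proof.
move=> b0; have [i0 bi0] : exists i, (0 < b i)%N.
  apply/existsP; apply: contraNT b0; rewrite negb_exists => /forallP b0.
  by apply/eqP/mnmP => i; rewrite mnm0E; apply/eqP; rewrite -leqn0 leqNgt b0.
case: (arg_minnP (P := fun i => (0 < b i)%N) (fun i : 'I_n.+1 => nat_of_ord i) bi0).
by move=> i bi imin; exists i.
Qed.

(** A generator [x^a] properly divides [x^b]. Either it still divides [x^b / x_i], or it uses all of
    [x_i^(b i)]; then some [x_j] with [j > i] has room left, and [x_j x^a / x_i], in [J] by strong
    stability, divides [x^b / x_i]. *)
Lemma sub_min_var_mem b i :
  J 'X_[b] -> ~ B b -> is_min_var b i -> J 'X_[(b - U_(i))%MM].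
Proof.
move=> /(monomial_generators_mem _ HB.1)[a Ba le_ab] nBb [bi0 imin].
apply/(monomial_generators_mem _ HB.1).
have ab := elimT mnm_lepP le_ab.
have [lt_ab|] := ltnP (a i) (b i).
  exists a => //; apply/mnm_lepP => k; have ak := ab k; rewrite mnmBE mnm1E.
  by case: eqP => [<-|_] /=; lia.
move=> ge_ab; have aib : a i = b i by have := ab i; lia.
have [j ltj] : exists j, (a j < b j)%N.
  apply/existsP; apply: contra_notT nBb; rewrite negb_exists => /forallP nlt.
  suff -> : b = a by [].
  by apply/mnmP => k; have := nlt k; have := ab k; lia.
have ij : (i < j)%N.
  have : (i <= j)%N by apply: imin; lia.
  by rewrite leq_eqVlt => /predU1P[/val_inj eij|//]; move: ltj; rewrite -eij; lia.
have Ja : J 'X_[a] by apply/(monomial_generators_mem _ HB.1); exists a; rewrite ?lepm_refl.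
have ai0 : (0 < a i)%N by rewrite aib.
have /(monomial_generators_mem _ HB.1)[a' Ba' le_a'] := HJs Ja ij ai0.
exists a' => //; apply: lepm_trans le_a' _; apply/mnm_lepP => k.
rewrite mnmDE !mnmBE !mnm1E; have ak := ab k.
case: (eqVneq j k) => [<-|_] /=; last lia.
have /negbTE-> : i != j by rewrite neq_ltn ij.
by rewrite /= !subn0; lia.
Qed.

Lemma g_poly_total b : J 'X_[b] -> exists g, g_poly J B G b g.
Proof.
have [d] := ubnP (mdeg b); elim: d b => // d IH b ltbd Jb.
have [bG|nbG] := boolP (b \in [seq f.1 | f <- G]).
  have Bb : B b by case: HG => _ hB _; apply/hB.
  by have [p bpG] := generator_marked Bb; exists p; apply: g_poly_gen.
have nBb : ~ B b by case: HG => _ hB _ /hB; apply/negP.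
(* If [1] were in [J], it would be a generator. *)
have b0 : b != 0%MM.
  apply: contra_notN nBb => /eqP b0.
  have [a Ba le_ab] := (monomial_generators_mem b HB.1).1 Jb.
  suff -> : b = a by [].
  move: le_ab => /mnm_lepP le_ab; apply/mnmP => i; have := le_ab i.
  by rewrite b0 mnm0E; lia.
have [i imin] := exists_min_var b0.
have [|//|g gP] := IH (b - U_(i))%MM; last first.
- by exists ('X_i * g); apply: g_poly_mul imin gP.
- exact: sub_min_var_mem imin.
have le_ib : (U_(i) <= b)%MM.
  by apply/mnm_lepP => k; rewrite mnm1E; case: eqP => // <-; case: imin.
move: ltbd; rewrite -[in X in (X < _)%N](submK le_ib) mdegD mdeg1.
by rewrite addn1 ltnS.
Qed.

(** The recursion only multiplies by [min(x^b)], which exceeds no variable of the head of [f], so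
    the star condition persists. *)
Lemma g_poly_shape b g : g_poly J B G b g ->
  exists2 f, f \in G & star_multiple f.1 b /\ g = f.2 * 'X_[b - f.1].
Proof.
elim=> {b g} [b p Bb bpG|b i g Jb nBb [bi0 imin] _ [f fG [/star_multipleP[le_f star] gE]]].
  exists (b, p) => //=; split; first exact: star_multiple_refl.
  have -> : (b - b = 0)%MM by apply/mnmP => k; rewrite mnmBE subnn mnm0E.
  by rewrite mpolyX0 mulr1.
have le_ib : (U_(i) <= b)%MM.
  by apply/mnm_lepP => k; rewrite mnm1E; case: eqP => // <-.
have fb k : (f.1 k <= b k - (i == k))%N by have := (elimT mnm_lepP le_f) k; rewrite mnmBE mnm1E.
exists f => //; split.
  apply/star_multipleP; split; first by apply/mnm_lepP => k; have := fb k; lia.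
  (* A variable of the cofactor is either the new factor [x_i] or already in the cofactor for
     [x^b / x_i]. *)
  move=> k l; rewrite mnmBE => bfk fl; have [eik|nik] := eqVneq i k.
    by rewrite -eik; apply: imin; have := fb l; lia.
  by apply: star => //; rewrite !mnmBE mnm1E (negbTE nik); lia.
rewrite gE mulrCA -mpolyXD; congr (_ * 'X_[_]); apply/mnmP => k.
by rewrite mnmDE !mnmBE mnm1E; have := fb k; have := (elimT mnm_lepP le_ib) k; rewrite mnm1E; lia.
Qed.

Lemma g_poly_coeff b g : g_poly J B G b g -> g@_b = 1.
Proof.
case/g_poly_shape=> f fG [/star_multipleP[le_fb _] ->].
by rewrite -[X in _@_X](submK le_fb) mcoeffMX marked_coeff.
Qed.

Lemma g_poly_homog b g : g_poly J B G b g -> g \is (mdeg b).-homog.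
Proof.
case/g_poly_shape=> f fG [/star_multipleP[le_fb _] ->].
rewrite -[X in mdeg X](submK le_fb) mdegD addnC.
by apply: dhomogM; rewrite ?dhomogX // marked_homog.
Qed.

(** * Ranks of cofactors *)

(** In degree at most [m] the exponents are digits in base [m + 1], the top variable being the most
    significant. [inord] turns [e] into a digit function on [nat]. *)
Definition rank (m : nat) (e : 'X_{1..n.+1}) : nat :=
  (\sum_(k < n.+1) e (inord k) * m.+1 ^ k)%N.

Lemma rank_lex m (d e : 'X_{1..n.+1}) (j : 'I_n.+1) :
  (e j < d j)%N -> (forall k : 'I_n.+1, (j < k)%N -> e k = d k) ->
  (mdeg e <= m)%N -> (rank m e < rank m d)%N.
Proof.
move=> ltj above em.
apply: (lex_digits_lt (a := fun k => e (inord k)) (b := fun k => d (inord k)) (j := j)) => //.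
- by rewrite inord_val.
- by move=> k /andP[jk kn]; apply: above; rewrite inordK.
- by move=> k; rewrite ltnS (leq_trans (mnm_le_mdeg _ _)).
Qed.

(* The star decomposition is unique; taking a maximum over it spares proving so. *)
Definition max_rank (m : nat) (c : 'X_{1..n.+1}) : nat :=
  \max_(f <- G | star_multiple f.1 c) rank m (c - f.1)%MM.

(** Here [c] is the cofactor of [b] plus a tail term [t] of [f]. As [t] is outside [J], no head
    divides it, so every star cofactor of [c] is lexicographically smaller. *)
Lemma max_rank_tail m b g c : mdeg b = m -> g_poly J B G b g ->
  c \in msupp g -> c != b -> divisible_by_head c -> (max_rank m c < max_rank m b)%N.
Proof.
move=> bm gP cg cb cJ; have c_m : mdeg c = m.
  by rewrite -bm; apply: (dhomogP _ _ _ (g_poly_homog gP)).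
have [f fG [star gE]] := g_poly_shape gP.
apply: leq_trans (_ : rank m (b - f.1)%MM <= _)%N; last first.
  exact: leq_bigmax_seq.
have [le_fb _] := elimT (star_multipleP _ _) star.
move: cg; rewrite gE (perm_mem (msuppMX _ _)) => /mapP[t tf cE].
have tN : ~~ divisible_by_head t.
  apply: marked_tail fG tf _; apply: contra cb => /eqP tE.
  by rewrite cE tE submK.
have lt_rank (f' : 'X_{1..n.+1} * {mpoly K[n.+1]}) : f' \in G -> star_multiple f'.1 c ->
    (rank m (c - f'.1)%MM < rank m (b - f.1)%MM)%N.
  move=> fG' star'; have nle : ~~ (f'.1 <= t)%MM.
    by apply: contra tN => le_t; apply/hasP; exists f'.
  have [j ltj above] := star_multiple_lex star' cE nle.
  by apply: rank_lex ltj above _; rewrite (leq_trans (mdegB _ _)) ?c_m.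
(* An empty maximum is [0], so the strict bound needs a positive rank; rank [0] would give [c = t],
   outside [J]. *)
have pos : (0 < rank m (b - f.1)%MM)%N.
  rewrite lt0n; apply: contra tN => /eqP; rewrite /rank => rank0.
  suff -> : t = c by [].
  rewrite cE; apply/mnmP => k; rewrite mnmDE.
  have /eqP := rank0; rewrite sum_nat_eq0 => /forallP/(_ k).
  by rewrite inord_val muln_eq0 expn_eq0 orbF /= => /eqP->.
rewrite /max_rank big_seq_cond.
case: (rank m (b - f.1)%MM) pos lt_rank => // r _ lt_rank.
by rewrite ltnS; apply/bigmax_leqP_seq => f' fG' /andP[_ star']; rewrite -ltnS lt_rank.
Qed.

(** * The weight that reduction steps decrease *)

(** The base exceeds the number of terms of degree at most [m], so one term outweighs all terms of
    smaller rank together. *)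
Definition weight (m : nat) (h : {mpoly K[n.+1]}) : nat :=
  (\sum_(t : 'X_{1..n.+1 < m.+1} | (val t \in msupp h) && divisible_by_head (val t))
     #|{: 'X_{1..n.+1 < m.+1}}|.+1 ^ max_rank m (val t))%N.

Lemma weight_red_step m h h' :
  red_step J B G m h h' -> (weight m h' < weight m h)%N.
Proof.
case=> _ [b [g [bh [Jb bm gP] ->]]].
have ltb : (mdeg b < m.+1)%N by rewrite bm.
pose t0 := BMultinom ltb; pose r (t : 'X_{1..n.+1 < m.+1}) := max_rank m (val t).
have small := @sum_expn_lt _ (fun t => r t < max_rank m b)%N r _ (fun _ => id).
rewrite /weight [in ltnRHS](bigD1 t0) /=; last by rewrite bh; apply/divisible_by_headP.
set rest := (X in (_ + X)%N); move: small; rewrite -(ltn_add2r rest).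
apply: leq_ltn_trans; rewrite {}/rest.
(* Termwise comparison: a term of [J] in the new polynomial either has rank below that of [b], or
   already occurs in [h] and differs from [b]. *)
rewrite [leqLHS]big_mkcond [X in (_ <= X + _)%N]big_mkcond.
rewrite [X in (_ <= _ + X)%N]big_mkcond -big_split leq_sum //= => t _.
case: ifP => // /andP[th' tJ].
have [/= _|] := ltnP (r t) (max_rank m b); first exact: leq_addr.
rewrite leqNgt => nlt.
(* The coefficient at [b] cancels, since [g] has coefficient [1] there. *)
have t_b : val t != b.
  apply: contraTneq th' => ->.
  by rewrite mcoeff_msupp negbK mcoeffB mcoeffZ (g_poly_coeff gP) mulr1 subrr.
suff th : val t \in msupp h by rewrite th tJ /= -val_eqE t_b.
have := msuppB_le th'; rewrite mem_cat => /orP[//|/msuppZ_le tg].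
by case/negP: nlt; apply: max_rank_tail gP tg t_b tJ.
Qed.

(** * Reduced forms and termination *)

Lemma red_step_homog m h h' : red_step J B G m h h' -> h' \is m.-homog.
Proof.
case=> h_m [b [g [bh [Jb <- gP] ->]]].
by rewrite rpredB ?rpredZ ?(g_poly_homog gP) // (dhomogP _ _ _ h_m b bh).
Qed.

Lemma red_step_ideal m h h' : red_step J B G m h h' -> marked_ideal G (h - h').
Proof.
case=> _ [b [g [_ [_ _ gP] ->]]]; have [f fG [_ ->]] := g_poly_shape gP.
rewrite opprB addrC subrK mulrC scalerAl; apply: ideal_gen_mem.
exact: map_f.
Qed.

(** Induction on the weight: any term of [J] in [h] can be reduced, and without such a term [h] is
    its own reduced form. *)
Lemma reduces_to_reduced_form m h : h \is m.-homog ->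
  exists2 h0, clos_refl_trans _ (red_step J B G m) h h0 &
    reduced_form J (marked_ideal G) h h0.
Proof.
have [w] := ubnP (weight m h); elim: w h => // w IH h ltw h_m.
have [/hasP[b bh bJ]|nJ] := boolP (has divisible_by_head (msupp h)).
  have Jb := elimT (divisible_by_headP _) bJ.
  have [g gP] := g_poly_total Jb.
  have bm := dhomogP _ _ _ h_m b bh.
  have step : red_step J B G m h (h - h@_b *: g) by split=> //; exists b, g.
  have [|h0 red [h0_hom h0I h0N]] := IH _ _ (red_step_homog step).
    exact: leq_trans (weight_red_step step) ltw.
  exists h0; first by apply: rt_trans red; apply: rt_step.
  split=> //; rewrite -[h](subrK (h - h@_b *: g)) -addrA.
  by apply: ideal_genD h0I; apply: red_step_ideal step.
exists h; first exact: rt_refl.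
split; first exact: homogE h_m.
  by rewrite subrr; exists [::]; rewrite big_nil.
by move=> c ch /divisible_by_headP cJ; case/hasP: nJ; exists c.
Qed.

Lemma red_step_noetherian m :
  ~ exists h : nat -> {mpoly K[n.+1]}, forall k, red_step J B G m (h k) (h k.+1).
Proof.
case=> h step; have le_w k : (weight m (h k) + k <= weight m (h 0))%N.
  elim: k => [|k IH]; first by rewrite addn0.
  by apply: leq_trans IH; rewrite addnS -addSn leq_add2r weight_red_step.
(* One step more than the initial weight allows. *)
by have := le_w (weight m (h 0%N)).+1; rewrite addnS leqNgt ltnS leq_addl.
Qed.

End MarkedSet.

Theorem proposition3p6 (K : fieldType) (n : nat)
    (J : {mpoly K[n.+1]} -> Prop) (B : 'X_{1..n.+1} -> Prop)
    (G : seq ('X_{1..n.+1} * {mpoly K[n.+1]}))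
    (HJ : monomial_ideal J) (HJs : strongly_stable J)
    (HB : minimal_monomial_generators B J)
    (HG : marked_set J B G) (m : nat) :
  (forall b : 'X_{1..n.+1}, J 'X_[b] -> mdeg b = m -> ~ B b ->
     exists2 h0 : {mpoly K[n.+1]},
       clos_refl_trans _ (red_step J B G m) 'X_[b] h0 &
       reduced_form J (marked_ideal G) 'X_[b] h0)
  /\ ~ (exists h : nat -> {mpoly K[n.+1]},
          forall k : nat, red_step J B G m (h k) (h k.+1)).
Proof.
split; last exact: (red_step_noetherian HB HG).
by move=> b _ bm _; apply: (reduces_to_reduced_form HJs HB HG); rewrite dhomogX; apply/eqP.
Qed.
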